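(* Let $d\ge 1$ and let $\mathcal{F}\subseteq \binom{\mathbb{N}}{d}$ be a finite compressed family. Then for every family $\mathcal{F}'\subseteq \binom{\mathbb{N}}{d}$ with $|\mathcal{F}'|=|\mathcal{F}|$ one has $|\mathrm{Inc}(\mathcal{F}')|\ge|\mathrm{Inc}(\mathcal{F})|$.
   Context: $\mathbb{N}=\{1,2,3,\dots\}$. For $d\ge1$, $\binom{\mathbb{N}}{d}$ is the set of $d$-element subsets of $\mathbb{N}$; an element is written $\mathbf{u}=(u_1,\ldots,u_d)$ with $u_1<\cdots<u_d$. The squashed order on $\binom{\mathbb{N}}{d}$: $\mathbf{u}<\mathbf{v}$ iff the largest element of the symmetric difference $(\mathbf{u}\setminus\mathbf{v})\cup(\mathbf{v}\setminus\mathbf{u})$ belongs to $\mathbf{v}$; it is a well-order. A finite family $\mathcal{F}\subseteq\binom{\mathbb{N}}{d}$ is compressed if it consists of the $|\mathcal{F}|$ smallest elements of $\binom{\mathbb{N}}{d}$ in the squashed order. Let $\mathrm{Inc}_1$ be the set of maps $\pi\colon\mathbb{N}\to\mathbb{N}$ with $\pi(j)<\pi(j+1)$ and $\pi(j)\le j+1$ for all $j\ge1$. Such $\pi$ acts on $\mathbf{u}\in\binom{\mathbb{N}}{d}$ by $\pi(\mathbf{u})=(\pi(u_1),\ldots,\pi(u_d))$. For $\mathcal{F}\subseteq\binom{\mathbb{N}}{d}$, its Inc-image is $\mathrm{Inc}(\mathcal{F})=\{\pi(\mathbf{u})\mid \mathbf{u}\in\mathcal{F},\ \pi\in\mathrm{Inc}_1\}$.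 *)

(* Defs.v *)
From mathcomp Require Import all_boot.
Set Implicit Arguments. Unset Strict Implicit. Unset Printing Implicit Defensive.

(* A d-element subset u = (u_1 < ... < u_d) of N = {1,2,...}, as a strictly
   increasing sequence of positive naturals of length d. *)
Definition in_binom (d : nat) (u : seq nat) : bool :=
  [&& size u == d, sorted ltn u & all (fun x => 0 < x) u].

Definition symdiff (u v : seq nat) : seq nat :=
  [seq x <- u ++ v | (x \in u) != (x \in v)].

Definition squashed_lt (u v : seq nat) : bool :=
  (symdiff u v != [::]) && ((\max_(x <- symdiff u v) x) \in v).

(* A finite family (uniq list) F of d-subsets is compressed iff it is an initial
   segment of the squashed well-order, i.e. consists of the |F| smallest
   elements of binom(N,d). *)
Definition compressed (d : nat) (F : seq (seq nat)) : Prop :=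
  forall u v, u \in F -> in_binom d v -> squashed_lt v u -> v \in F.

Definition Inc1 (pi : nat -> nat) : Prop :=
  forall j, 0 < j -> [&& 0 < pi j, pi j < pi j.+1 & pi j <= j.+1].

Definition IncImage (F : seq (seq nat)) (w : seq nat) : Prop :=
  exists u pi, u \in F /\ Inc1 pi /\ w = map pi u.

Definition has_card (A : seq nat -> Prop) (n : nat) : Prop :=
  exists s : seq (seq nat), [/\ uniq s, size s = n & forall x, A x <-> x \in s].

(* Main.v *)
Require Import Defs.
From mathcomp Require Import all_boot zify.
Set Implicit Arguments. Unset Strict Implicit. Unset Printing Implicit Defensive.

(** Written with its largest element first, [t :: v] has as Inc-image itself and
    all [t.+1 :: w] with [w] in the Inc-image of [v].  Let [n + h_d(n)] be the size
    of the Inc-image of the first [n] sets in the squashed order.  For a family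
    of [a + b] sets of which [b] have the largest occurring maximum [T], the
    images with maximum [T.+1] number at least [b + h_(d-1)(b)] by induction on
    [d], and the other images contain both the family itself and the image of
    the remaining [a] sets, so number at least [max(a + b, a + h_d(a))].  It
    remains to see that
      [h_d(a + b) <= h_(d-1)(b) + max(b, h_d(a))],
    which follows from the recursive structure of the increments of [h_d]: in
    the word they form, cut at a full binomial coefficient, every factor has sum
    at most that of the prefix and at least that of the suffix of the same
    length. *)

(** * Prefix sums of words *)

Definition psum (s : seq nat) (x : nat) : nat := sumn (take x s).

Lemma psum0 s : psum s 0 = 0. Proof. by rewrite /psum take0. Qed.

Lemma psum_size s : psum s (size s) = sumn s.
Proof. by rewrite /psum take_size. Qed.

Lemma psum_cat s t x : psum (s ++ t) x =
  if x <= size s then psum s x else psum s (size s) + psum t (x - size s).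
Proof.
rewrite /psum take_size take_cat; case: (ltngtP x (size s)) => //= [_|->].
  by rewrite sumn_cat.
by rewrite subnn take0 cats0 take_size.
Qed.

Lemma psum_catr s t y :
  psum (s ++ t) (size s + y) = psum s (size s) + psum t y.
Proof.
rewrite psum_cat; case: ifP => [le|_]; last by rewrite addKn.
have -> : y = 0 by lia.
by rewrite addn0 psum0 addn0.
Qed.

Lemma leq_psum s x y : x <= y -> psum s x <= psum s y.
Proof.
rewrite /psum; elim: s x y => [|a s IHs] [|x] [|y] //= lexy.
by rewrite leq_add2l IHs.
Qed.

(** * Balanced words and their concatenation *)

(* [subadd] says that a factor has at most the sum of the prefix of the same
   length, [cosubadd] that it has at least the sum of the suffix. *)
Definition subadd s := forall x y,
  x + y <= size s -> psum s (x + y) <= psum s x + psum s y.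

Definition cosubadd s := forall x y,
  x <= size s -> y <= size s -> size s <= x + y ->
  psum s (size s) + psum s (x + y - size s) <= psum s x + psum s y.

Definition balanced s := subadd s /\ cosubadd s.

Definition prefix_dom s t := forall x,
  x <= size s -> x <= size t -> psum t x <= psum s x.

Definition suffix_dom s t := forall l,
  l <= size s -> l <= size t ->
  psum t (size t) + psum s (size s - l) <= psum s (size s) + psum t (size t - l).

(** With [y <= x], compare the factor of length [y] after position [x] with the prefix of length
    [y]. If the factor crosses the cut, its part in [t] is dominated by a prefix of [s], and
    cosubadditivity of [s] finishes. If it lies in [t], subadditivity moves it to the start of [t],
    and prefix domination from there to the start of [s]. *)
Lemma subadd_cat s t :
  balanced s -> balanced t -> prefix_dom s t -> subadd (s ++ t).
Proof.
move=> [subs cos] [subt _] pre.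
suff wl x y : y <= x -> x + y <= size (s ++ t) ->
    psum (s ++ t) (x + y) <= psum (s ++ t) x + psum (s ++ t) y.
  move=> x y le; case: (leqP y x) => [/wl->//|/ltnW lexy].
  by rewrite addnC [leqRHS]addnC wl // addnC.
rewrite size_cat !psum_cat => leyx le.
case: (leqP (x + y) (size s)) => [lexys|ltxys].
  rewrite (leq_trans (leq_addr y x) lexys) (leq_trans (leq_addl x y) lexys).
  exact: subs.
case: (leqP x (size s)) => [lexs|ltxs].
  have leys : y <= size s by lia.
  rewrite leys.
  have := cos x y lexs leys (ltnW ltxys).
  have := pre (x + y - size s); lia.
have := subt (x - size s) y.
rewrite (_ : x - size s + y = x + y - size s); last lia.
move=> /(_ ltac:(lia)).
case: (leqP y (size s)) => [leys|ltys].
  have := pre y; lia.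
have := subt (size s) (y - size s).
rewrite (_ : size s + (y - size s) = y); last lia.
move=> /(_ ltac:(lia)).
have := pre (size s); lia.
Qed.

Lemma cosubadd_cat s t :
  balanced s -> balanced t -> suffix_dom s t -> cosubadd (s ++ t).
Proof.
move=> [_ cos] [subt cot] suf.
suff wl x y : y <= x -> x <= size (s ++ t) -> size (s ++ t) <= x + y ->
    psum (s ++ t) (size (s ++ t)) + psum (s ++ t) (x + y - size (s ++ t))
      <= psum (s ++ t) x + psum (s ++ t) y.
  move=> x y lex ley le; case: (leqP y x) => [leyx|/ltnW lexy]; first exact: wl.
  by rewrite addnC [x + y]addnC addnC [leqRHS]addnC wl // addnC.
rewrite size_cat => leyx lex le.
set z := x + y - _.
have -> : psum (s ++ t) (size s + size t) = psum s (size s) + psum t (size t).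
  by rewrite -size_cat !psum_size sumn_cat.
rewrite !psum_cat.
case: (leqP y (size s)) => [leys|ltys]; last first.
  rewrite [x <= _]leqNgt (leq_trans ltys leyx) /=.
  case: (leqP z (size s)) => [lezs|ltzs]; last first.
    have := cot (x - size s) (y - size s).
    rewrite (_ : x - size s + (y - size s) - size t = z - size s); last lia.
    lia.
  (* The factor from [z] to [x] crosses the cut, while the suffix from [y] lies in [t]. The last
     [size s - z] letters of the suffix are dominated by the end of [s], the others by the prefix of
     [t] of length [x - size s]. *)
  have := suf (size s - z); rewrite (_ : size s - (size s - z) = z); last lia.
  rewrite (_ : size t - (size s - z) = x - size s + (y - size s)); last lia.
  have := subt (x - size s) (y - size s); lia.
rewrite (_ : z <= size s); last lia.
case: (leqP x (size s)) => [lexs|ltxs].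
  (* The factor lies in [s]. Split it at [w]: the part after [w] dominates the end of [s] that
     follows [y], and the part before it, of length [size t], dominates an end of [s] and so all of
     [t]. *)
  have := cos x y lexs leys; set w := x + y - size s => cw.
  have := cos w (size s - size t).
  rewrite (_ : w + (size s - size t) - size s = z); last lia.
  have := suf (size t); rewrite subnn psum0; lia.
(* Factor and suffix overlap between [y] and [x]. Without the overlap, both have length [y - z], the
   first inside [s] and the second at the end of [t]. *)
have := cos y (size s - (y - z)).
rewrite (_ : y + (size s - (y - z)) - size s = z); last lia.
have := suf (y - z); rewrite (_ : size t - (y - z) = x - size s); last lia.
lia.
Qed.

(** * The growth words and their balance *)

(* The i-th letter of [growth e d], plus one, is the number of sets in the
   Inc-image of the i-th d-subset of {1, ..., e + d} that are not in the Inc-image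
   of an earlier one; so the prefix sums of [growth e d] are the numbers h_d. *)
Fixpoint growth (e d : nat) {struct e} : seq nat :=
  match e with
  | 0 => [:: d]
  | e'.+1 => (fix growthe d := match d with
                          | 0 => [:: 0]
                          | d'.+1 => growth e' d'.+1 ++ growthe d'
                          end) d
  end.

Lemma growth0d d : growth 0 d = [:: d]. Proof. by []. Qed.
Lemma growthe0 e : growth e 0 = [:: 0]. Proof. by case: e. Qed.
Lemma growthSS e d : growth e.+1 d.+1 = growth e d.+1 ++ growth e.+1 d. Proof. by []. Qed.

(** Both sides satisfy Pascal's recursion. In terms of sets: the Inc-image of all [d.+1]-subsets of
    {1, ..., e + d + 1} consists of all those of {1, ..., e + d + 2}, which is a gain of binom(e + d
    + 1, d). *)
Lemma sumn_growth e d : sumn (growth e d.+1) = size (growth e.+1 d).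
Proof.
elim: e d => [|e IHe] d.
  by elim: d => [|d IHd] //; rewrite growthSS size_cat -IHd /=; lia.
elim: d => [|d IHd]; first by rewrite growthSS sumn_cat IHe !growthe0.
by rewrite growthSS sumn_cat IHd IHe [in RHS]growthSS size_cat.
Qed.

Lemma size_growth_gt0 e d : 0 < size (growth e d).
Proof. by elim: e d => [|e IHe] [|d] //; rewrite growthSS size_cat ltn_addr. Qed.

Lemma leq_size_growth e d : e <= size (growth e d.+1).
Proof.
elim: e => [|e IHe] //; rewrite growthSS size_cat.
have := size_growth_gt0 e.+1 d; lia.
Qed.

(** Each word starts with the one for the next smaller [e], so h_d does not depend on the [e] chosen
    to compute it. *)
Lemma growth_prefix e k d x :
  x <= size (growth e d) -> psum (growth (e + k) d) x = psum (growth e d) x.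
Proof.
move=> le; elim: k => [|k IHk]; first by rewrite addn0.
case: d le IHk => [|d] le IHk; first by rewrite !growthe0.
rewrite addnS growthSS psum_cat ifT //.
elim: k {IHk} => [|k IHk]; rewrite ?addn0 // addnS growthSS size_cat; lia.
Qed.

Lemma growth_prefix_eq e e' d x :
  x <= size (growth e d) -> x <= size (growth e' d) -> psum (growth e d) x = psum (growth e' d) x.
Proof.
move=> le le'; case: (leqP e e') => [/subnKC<-|/ltnW/subnKC<-];
  by rewrite growth_prefix.
Qed.

Lemma psum_growth1 e d : psum (growth e d) 1 = d.
Proof.
rewrite (@growth_prefix_eq e 0) ?size_growth_gt0 //.
by rewrite growth0d /psum /= addn0.
Qed.

(** For [e > 0] the second word is a suffix of the first, and equality holds; for [e = 0] the words
    are single letters. *)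
Lemma growth_suffix e d k : suffix_dom (growth e (d + k)) (growth e d).
Proof.
elim: k => [|k IHk] l; first by rewrite addn0 => *; lia.
case: e IHk => [|e] IHk; first by rewrite !growth0d /psum; case: l => [|[|l]] //=; lia.
rewrite addnS growthSS size_cat => _ le2.
have lek : size (growth e.+1 d) <= size (growth e.+1 (d + k)).
  elim: k {IHk} => [|k IHk]; rewrite ?addn0 // addnS growthSS size_cat; lia.
rewrite -addnBA ?psum_catr; last lia.
have := IHk l; lia.
Qed.

(** By induction on [e]: cut a prefix of [growth e' d] at the length of [growth e d.+1].
    Subadditivity moves the rest to the start, where it agrees with the second block
    [growth e.+1 d]. *)
Lemma growth_prefix_dom e e' d :
  subadd (growth e' d) -> prefix_dom (growth e d.+1) (growth e' d).
Proof.
move=> sub; elim: e => [|e IHe] x.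
  rewrite growth0d /=; case: x => [|[|x]] // _ _; first by rewrite !psum0.
  by rewrite psum_growth1 /psum /=; lia.
rewrite growthSS psum_cat size_cat => lex lex'.
case: (leqP x (size (growth e d.+1))) => [lexp|ltpx]; first exact: IHe.
have := sub (size (growth e d.+1)) (x - size (growth e d.+1)).
rewrite subnKC; last exact: ltnW.
rewrite [psum _ (x - _)](@growth_prefix_eq _ e.+1); try lia.
have := IHe (size (growth e d.+1)); lia.
Qed.

Lemma growth_suffix_dom e d k :
  cosubadd (growth e (d + k.+1)) -> suffix_dom (growth e (d + k.+1)) (growth e.+1 d).
Proof.
elim: d k => [|d IHd] k co l.
  rewrite growthe0 => le; case: l le => [|[|l]] // le _; rewrite ?subn0; first lia.
  by rewrite /psum /= add0n addn0 leq_psum // leq_subr.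
rewrite growthSS size_cat => lel lel'.
have := IHd k.+1; rewrite -addSnnS => /(_ co) {}IHd.
case: (leqP l (size (growth e.+1 d))) => [leq|ltq].
  rewrite -addnBA // !psum_catr; have := IHd l; lia.
set q := size (growth e.+1 d) in IHd lel' ltq *; set p := size (growth e d.+1) in lel' *.
have -> : p + q - l = p - (l - q) by lia.
rewrite psum_catr -/p [psum (_ ++ _) (_ - _)]psum_cat leq_subr.
have := @growth_suffix e d.+1 k.+1 (l - q).
have := IHd q; rewrite subnn psum0.
set f := psum (growth e (d.+1 + k.+1)); set N := size (growth e (d.+1 + k.+1)).
(* The last [q] letters are settled by induction. The [l - q] before them are dominated by the
   suffix of that length of the longer word, which cosubadditivity moves to just before its last [q]
   letters. *)
have := co (N - q) (N - (l - q)); rewrite -/N -/f.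
rewrite (_ : N - q + _ - N = N - l); last lia.
rewrite -/p -/q; lia.
Qed.

Lemma balanced_growth e d : balanced (growth e d).
Proof.
have b1 a : balanced [:: a].
  by split=> x y; rewrite /psum /=; case: x => [|[|x]]; case: y => [|[|y]] //=; lia.
elim: e d => [|e IHe] d; first exact: b1.
elim: d => [|d IHd]; first exact: b1.
rewrite growthSS; split.
  by apply: subadd_cat => //; apply: growth_prefix_dom; case: IHd.
apply: cosubadd_cat => //.
by have := @growth_suffix_dom e d 0; rewrite addn1; apply; case: (IHe d.+1).
Qed.

(** * The splitting inequality for h_d *)

Lemma psum_growth_size e d : psum (growth e d.+1) (size (growth e d.+1)) = size (growth e.+1 d).
Proof. by rewrite psum_size sumn_growth. Qed.

Lemma leq_psum_size s x : psum s x <= psum s (size s).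
Proof.
case: (leqP x (size s)) => [|/ltnW le]; first exact: leq_psum.
by rewrite /psum take_size take_oversize.
Qed.

Lemma psum_growth_split e d a b e' :
  a + b <= size (growth e d.+1) -> b <= size (growth e' d) ->
  psum (growth e d.+1) (a + b) <= psum (growth e' d) b + maxn b (psum (growth e d.+1) a).
Proof.
elim/ltn_ind: d e a b e' => d IHd; elim=> [|e IHe] a b e'.
  rewrite growth0d => /= leab _; case: b leab => [|b] leab; first by rewrite addn0; lia.
  have [-> ->] : a = 0 /\ b = 0 by lia.
  by rewrite psum_growth1 /psum /=; lia.
rewrite growthSS size_cat => leab leb.
case: (leqP (a + b) (size (growth e d.+1))) => [le|lt].
  by rewrite !psum_cat le (leq_trans (leq_addr b a) le); apply: IHe.
(* The first block is used up and contributes exactly the length of [growth e.+1 d]. *)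
rewrite psum_cat ifF ?psum_growth_size; last by rewrite leqNgt lt.
set rho := a + b - _.
case: (leqP (size (growth e.+1 d)) b) => [leqb|ltbq].
  have := leq_psum (growth e' d) leqb.
  rewrite -(@growth_prefix_eq e.+1) //; last exact: leq_trans leb.
  have := leq_psum_size (growth e.+1 d) rho; lia.
rewrite [psum _ b](@growth_prefix_eq e' e.+1) //; last exact: ltnW.
case: (leqP (size (growth e d.+1)) a) => [lepa|ltap].
  rewrite -(subnKC lepa) psum_catr psum_growth_size.
  (* That contribution also occurs in the sum for [a], so subadditivity of h_d remains. *)
  have [sub _] := balanced_growth e.+1 d.
  have := sub (a - size (growth e d.+1)) b; rewrite -/rho.
  rewrite (_ : a - _ + b = rho); lia.
rewrite psum_cat (ltnW ltap).
case: d IHd IHe leab leb lt @rho ltbq ltap => [|d] IHd IHe leab leb lt rho ltbq ltap.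
  by move: ltbq lt; rewrite growthe0 /=; lia.
have eR := psum_growth_size e d.
move: ltbq; rewrite [growth e.+1 d.+1]growthSS size_cat => ltbq.
case: (leqP (size (growth e d.+1)) b) => [leqb|ltbq'].
  (* Now [b] uses up the first block of its own word. Removing the first blocks from [a] and [b]
     leaves the inequality one dimension lower, for [r] and [s]. *)
  rewrite -(subnKC leqb) psum_catr eR.
  set s := b - _.
  have IH r := IHd d (ltnSn d) e.+1 r s e.+1.
  case: e {IHe} leab leb lt @rho ltap eR ltbq leqb @s IH => [|e] leab leb lt rho ltap eR ltbq leqb s IH.
    have a0 : a = 0 by move: ltap; rewrite growth0d /=; lia.
    have -> : rho = s by rewrite /rho /s a0 !growth0d /=; lia.
    have := IH 0; rewrite add0n psum0 growthSS size_cat; lia.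
  move: lt ltap @rho; rewrite growthSS size_cat => lt ltap rho.
  case: (leqP (size (growth e d.+2)) a) => [lepa|ltap'].
    rewrite -[in psum _ a](subnKC lepa) psum_catr psum_growth_size.
    set r := a - _.
    have := IH r; rewrite (_ : r + s = rho); last lia.
    rewrite [psum _ r](_ : _ = psum (growth e.+1 d.+1) r); last first.
      by rewrite growthSS psum_cat ifT //; lia.
    rewrite [growth e.+2 d.+1]growthSS size_cat; lia.
  (* Here [a] is too small to lose a block, but then [rho <= s], and the lower inequality with [0]
     in place of [r] suffices. *)
  have : psum (growth e.+1 d.+1 ++ growth e.+2 d) rho <= psum (growth e.+1 d.+1 ++ growth e.+2 d) s.
    by apply: leq_psum; lia.
  have := IH 0; rewrite add0n psum0 growthSS size_cat; lia.
case: e {IHe} leab leb lt @rho ltap eR ltbq ltbq' => [|e] leab leb lt rho ltap eR ltbq ltbq'.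
  by move: ltbq' ltap lt; rewrite !growth0d /=; lia.
move: lt ltap @rho; rewrite [growth e.+1 d.+2]growthSS size_cat => lt ltap rho.
have lepa : size (growth e d.+2) <= a by lia.
rewrite -[in psum _ a](subnKC lepa) psum_catr psum_growth_size.
set r := a - _.
(* Both [r] and [b] are at most the length of this word and together exceed it by [rho], so
   cosubadditivity applies. *)
have [_ co] := balanced_growth e.+1 d.+1.
have := co r b; rewrite (_ : r + b - _ = rho); last lia.
rewrite eR [psum (_ ++ _) b]psum_cat (ltnW ltbq').
rewrite [psum (_ ++ _) rho]psum_cat ifT; lia.
Qed.

(** * Inc-images as lists and the lower bound *)

(* Sets are listed in decreasing order from here on; an element of Inc_1 acts by
   adding 1 to the elements above some threshold. *)
Fixpoint shifts (r : seq nat) : seq (seq nat) :=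
  if r is t :: v then r :: map (cons t.+1) (shifts v) else [:: [::]].

Definition image_list (G : seq (seq nat)) := undup (flatten (map shifts G)).

Lemma mem_image_list G w :
  reflect (exists2 r, r \in G & w \in shifts r) (w \in image_list G).
Proof. by rewrite mem_undup; apply: flatten_mapP. Qed.

Lemma shifts_refl r : r \in shifts r.
Proof. by case: r => [|t v] /=; rewrite mem_head. Qed.

Lemma size_shifts r : size (shifts r) = (size r).+1.
Proof. by elim: r => //= t v IHv; rewrite size_map IHv. Qed.

Lemma shiftsP t v w : reflect (w = t :: v \/ exists2 w', w' \in shifts v & w = t.+1 :: w')
  (w \in shifts (t :: v)).
Proof.
rewrite /= inE; apply: (iffP orP) => [[/eqP->|/mapP[w' vw' ->]]|[->|[w' vw' ->]]].
- by left.
- by right; exists w'.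
- by left.
- by right; apply/mapP; exists w'.
Qed.

Lemma leq_image_list (G L : seq (seq nat)) :
  {subset image_list G <= L} -> size (image_list G) <= size L.
Proof. by move=> sub; apply: uniq_leq_size => //; apply: undup_uniq. Qed.

Lemma seq_argmax (T : eqType) (f : T -> nat) (s : seq T) : s != [::] ->
  exists2 x, x \in s & forall y, y \in s -> f y <= f x.
Proof.
elim: s => // a [|b s] IHs _.
  by exists a => [|y]; rewrite inE // => /eqP->.
have [//|x xs xmax] := IHs; case: (leqP (f a) (f x)) => [le|lt].
  exists x => [|y]; rewrite inE ?xs ?orbT //.
  by case/predU1P => [->//|/xmax].
exists a => [|y]; rewrite inE ?eqxx // => /predU1P[->//|/xmax h].
exact: leq_trans h (ltnW lt).
Qed.

Lemma leq_size_image_list d G e :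
  uniq G -> all (fun r => size r == d) G -> size G <= size (growth e d) ->
  size G + psum (growth e d) (size G) <= size (image_list G).
Proof.
elim: d G e => [|d IHd] G e.
  move=> _; rewrite growthe0; case: G => [|r [|? ?]] //=.
  by rewrite andbT => /nilP->.
have [n] := ubnP (size G); elim: n G => // n IHn G; rewrite ltnS => leGn uG dG leG.
have [->|nG] := eqVneq G [::]; first by rewrite psum0.
have [x0 x0G x0max] := seq_argmax (head 0) nG; set T := head 0 x0 in x0max.
pose top := filter (fun r => head 0 r == T) G.
pose low := filter (fun r => head 0 r != T) G.
pose tails := map behead top.
have topE r : r \in top -> r = T :: behead r.
  rewrite mem_filter => /andP[/eqP hr /(allP dG)].
  by case: r hr => //= a r ->.
have sizeG : size low + size top = size G.
  by rewrite !size_filter addnC -(count_predC (fun r => head 0 r == T) G).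
have top_gt0 : 0 < size top.
  by rewrite size_filter -has_count; apply/hasP; exists x0 => //=.
have utails : uniq tails.
  rewrite map_inj_in_uniq ?filter_uniq // => r s rt st eqb.
  by rewrite (topE r) // (topE s) // eqb.
have dtails : all (fun r => size r == d) tails.
  apply/allP => _ /mapP[r rt ->].
  by move: (rt); rewrite mem_filter => /andP[_ /(allP dG)]; rewrite {1}(topE r rt).
(* Used twice: with [L] the family itself, and with [L] the image of [low], whose maxima are still
   at most [T]. *)
have bound L : uniq L -> {subset L <= image_list G} ->
    (forall r, r \in L -> head 0 r <= T) ->
    size L + size (image_list tails) <= size (image_list G).
  move=> uL subL hL.
  rewrite -(size_map (cons T.+1) (image_list tails)) -size_cat.
  apply: uniq_leq_size.
    rewrite cat_uniq uL map_inj_uniq ?undup_uniq ?andbT; last by move=> ? ? [].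
    apply/hasPn => _ /mapP[w _ ->]; apply/negP => /hL /=; lia.
  move=> w; rewrite mem_cat => /orP[/subL//|/mapP[w' w't ->]].
  have [_ /mapP[r rt ->] w'r] := mem_image_list _ _ w't.
  apply/mem_image_list; exists r; first by move: rt; rewrite mem_filter => /andP[].
  by rewrite (topE r rt); apply/shiftsP; right; exists w'.
have boundG := bound G uG _ x0max.
have {}boundG : size G + size (image_list tails) <= size (image_list G).
  by apply: boundG => r rG; apply/mem_image_list; exists r => //; apply: shifts_refl.
have boundlow : size (image_list low) + size (image_list tails) <= size (image_list G).
  apply: bound; first exact: undup_uniq.
    move=> w /mem_image_list[r]; rewrite mem_filter => /andP[_ rG] wr.
    by apply/mem_image_list; exists r.
  move=> w /mem_image_list[r]; rewrite mem_filter => /andP[hr rG].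
  have := x0max r rG; case: r hr {rG} => [|t v] /= hr le.
    by rewrite inE => /eqP->.
  rewrite inE => /predU1P[->//|/mapP[w' _ ->]] /=.
  by rewrite ltn_neqAle hr.
(* Any word long enough to evaluate h_d at the number of tails serves. For [d = 0] every word has
   length 1, but the only possible tail is the empty set. *)
have [e' lee'] : exists e', size tails <= size (growth e' d).
  case: (d) dtails => [|k] dt; last by exists (size tails); apply: leq_size_growth.
  exists 0; apply: (@uniq_leq_size _ tails [:: [::]]) => // r /(allP dt).
  by rewrite inE => /nilP->.
have := IHd tails e' utails dtails lee'; rewrite size_map.
have dlow : all (fun r => size r == d.+1) low.
  by apply/allP => r; rewrite mem_filter => /andP[_ /(allP dG)].
have lowS : size low < n by lia.
have lowW : size low <= size (growth e d.+1) by lia.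
have := IHn low lowS (filter_uniq _ uG) dlow lowW.
have := @psum_growth_split e d (size low) (size top) e'.
rewrite sizeG; move: lee'; rewrite size_map => lee' /(_ leG lee').
move: boundG boundlow sizeG.
set n1 := size G; set n2 := size low; set n3 := size top.
set n4 := size (image_list G); set n5 := size (image_list low).
set n6 := size (image_list tails); lia.
Qed.

(** * Initial segments and the upper bound *)

(* The d-subsets of {1, ..., e + d} in squashed order. *)
Fixpoint squashed (e d : nat) {struct e} : seq (seq nat) :=
  (fix squashede d := if d is d'.+1 then
     (if e is e'.+1 then squashed e' d'.+1 else [::]) ++ map (cons (e + d'.+1)) (squashede d')
   else [:: [::]]) d.

Lemma squashede0 e : squashed e 0 = [:: [::]]. Proof. by case: e. Qed.
Lemma squashed0S d : squashed 0 d.+1 = map (cons d.+1) (squashed 0 d). Proof. by []. Qed.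
Lemma squashedSS e d :
  squashed e.+1 d.+1 = squashed e d.+1 ++ map (cons (e.+1 + d.+1)) (squashed e.+1 d).
Proof. by []. Qed.

Lemma size_squashed e d : size (squashed e d) = size (growth e d).
Proof.
elim: e d => [|e IHe]; elim=> [|d IHd] //.
  by rewrite squashed0S size_map IHd.
by rewrite squashedSS growthSS !size_cat size_map IHe IHd.
Qed.

Lemma path_gtn_size x v : path gtn x v -> all (leq 1) v -> 0 < x -> size v < x.
Proof.
elim: v x => //= y v IHv x /andP[/= ltyx pv] /andP[y0 v0] _.
exact: leq_ltn_trans (IHv y pv v0 y0) ltyx.
Qed.

Lemma mem_squashed e d w :
  (w \in squashed e d) = [&& size w == d, path gtn (e + d).+1 w & all (leq 1) w].
Proof.
elim: e d w => [|e IHe]; elim=> [|d IHd] w; rewrite ?squashede0.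
1,3: by case: w => // x w; rewrite inE.
  rewrite squashed0S; case: w => [|x w] /=; first by apply/mapP => -[].
  apply/mapP/idP => [[w' + [-> ->]]|].
    by rewrite IHd => /and3P[/eqP-> -> ->]; rewrite eqxx /= ltnS leqnn.
  rewrite eqSS => /and3P[/eqP sw /andP[/= xd pw] /andP[x0 w0]].
  have xE : x = d.+1 by have := path_gtn_size pw w0 x0; lia.
  by exists w; rewrite ?xE // IHd sw eqxx w0 andbT; move: pw; rewrite xE.
rewrite squashedSS mem_cat IHe; case: w => [|x w].
  by apply/mapP => -[].
apply/idP/idP => [/orP[|/mapP[w' + [-> ->]]]|].
- move=> /and3P[sw /= /andP[xe pw] w0]; apply/and3P; split=> //=.
  by rewrite pw andbT; lia.
- rewrite IHd => /and3P[sw pw w0]; apply/and3P; split=> //=.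
  by move: pw; rewrite addnS => ->; rewrite andbT; lia.
- rewrite /= => /and3P[sw /andP[xe pw] w0].
  have [xE|xne] := eqVneq x (e.+1 + d.+1).
    apply/orP; right; apply/mapP; exists w; last by rewrite xE.
    by case/andP: w0 => _ w0; rewrite IHd -eqSS sw w0 -addnS -xE pw.
  by rewrite sw pw w0; apply/orP; left; rewrite !andbT /=; lia.
Qed.

Lemma ltn_squashed e d u x : u \in squashed e d -> x \in u -> x < (e + d).+1.
Proof.
rewrite mem_squashed (path_sortedE (rev_trans ltn_trans)).
by move=> /and3P[_ /andP[/allP h _] _] /h.
Qed.

Lemma path_shifts x r w : path gtn x r -> w \in shifts r -> path gtn x.+1 w.
Proof.
elim: r x w => [|t v IHv] x w; first by rewrite inE => _ /eqP->.
move=> /= /andP[tx pv] /shiftsP[->|[w' w'v ->]] /=.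
  by rewrite pv andbT; apply: ltnW.
by rewrite (IHv t) // andbT ltnS.
Qed.

Lemma size_in_shifts r w : w \in shifts r -> size w = size r.
Proof.
elim: r w => [|t v IHv] w; first by rewrite inE => /eqP->.
by move=> /shiftsP[->//|[w' /IHv w'v ->]] /=; rewrite w'v.
Qed.

Lemma pos_shifts r w : all (leq 1) r -> w \in shifts r -> all (leq 1) w.
Proof.
elim: r w => [|t v IHv] w; first by rewrite inE => _ /eqP->.
move=> /= /andP[t0 v0] /shiftsP[->|[w' /IHv w'v ->]] /=; first by rewrite t0.
exact: w'v.
Qed.

Lemma shifts_squashed e d r w : r \in squashed e d -> w \in shifts r -> w \in squashed e.+1 d.
Proof.
rewrite !mem_squashed => /and3P[sr pr r0] wr.
by rewrite (size_in_shifts wr) sr (pos_shifts r0 wr) andbT addSn (path_shifts pr wr).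
Qed.

Lemma size_image_list_take e d n : n <= size (squashed e d) ->
  size (image_list (take n (squashed e d))) <= n + psum (growth e d) n.
(* For [e = 0] or [d = 0] there is a single set, with at most [d + 1] images. Otherwise, past the
   first block, every image is either a [d.+1]-subset of {1, ..., e + d + 2} or has maximum e + d +
   3 and a tail in the image of the first [m] tails; [L] lists both kinds. *)
Proof.
have base e' d' k : size (squashed e' d') = 1 -> k <= size (squashed e' d') ->
    size (image_list (take k (squashed e' d'))) <= k + psum (growth e' d') k.
  have sE x : x \in squashed e' d' -> size x = d' by rewrite mem_squashed => /and3P[/eqP].
  move: sE; case: (squashed e' d') => [|x []] // /(_ x (mem_head _ _)) sx _.
  case: k => [|[|k]] // _; rewrite psum_growth1 /= /image_list /= cats0.
  by rewrite (leq_trans (size_undup _)) // size_shifts sx.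
elim: e d n => [|e IHe] d n; first by apply: base; rewrite size_squashed.
elim: d n => [|d IHd] n; first by apply: base; rewrite squashede0.
have [le _|lt len] := leqP n (size (squashed e d.+1)).
  rewrite squashedSS growthSS psum_cat -size_squashed le takel_cat //; exact: IHe.
set m := n - size (squashed e d.+1).
have lem : m <= size (squashed e.+1 d) by move: len; rewrite squashedSS size_cat size_map; lia.
pose L := squashed e.+1 d.+1 ++ map (cons (e.+1 + d.+1).+1) (image_list (take m (squashed e.+1 d))).
have : size (image_list (take n (squashed e.+1 d.+1))) <= size L.
  apply: leq_image_list => w /mem_image_list[r].
  rewrite {1}squashedSS take_cat ltnNge (ltnW lt) /= mem_cat /L => /orP[rE wr|].
    by rewrite mem_cat (shifts_squashed rE wr).
  rewrite -map_take => /mapP[v vm ->] /shiftsP[->|[w' w'v ->]].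
    by rewrite squashedSS !mem_cat (map_f _ (mem_take vm)) orbT.
  rewrite mem_cat map_f ?orbT //; apply/mem_image_list; by exists v.
have := IHd m lem; rewrite /L squashedSS growthSS psum_cat !size_cat !size_map -size_squashed ifF; last lia.
rewrite -/m size_squashed psum_growth_size size_squashed; move: lt (size_squashed e d.+1).
rewrite /m; set k := size (squashed e d.+1).
set i1 := size (image_list (take n _)); set i2 := size (image_list _); lia.
Qed.

(** * Compressed families as initial segments *)

Lemma bigmax_mem (s : seq nat) : s != [::] -> \max_(x <- s) x \in s.
Proof.
move=> /(seq_argmax id)[x xs xmax].
have -> : \max_(x <- s) x = x; last by [].
apply/eqP; rewrite eqn_leq leq_bigmax_seq // andbT.
by apply/bigmax_leqP_seq => y ys _; apply: xmax.
Qed.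

Lemma squashed_ltP u v :
  reflect (exists m, [/\ m \in v, m \notin u &
                         forall x, m < x -> (x \in u) = (x \in v)])
    (squashed_lt u v).
Proof.
have memD x : (x \in symdiff u v) = ((x \in u) != (x \in v)).
  by rewrite mem_filter mem_cat; case: (x \in u); case: (x \in v).
apply: (iffP andP) => [[nD mv]|[m [mv mu mE]]].
  exists (\max_(x <- symdiff u v) x); split=> //.
    by have := bigmax_mem nD; rewrite memD mv; case: (_ \in u).
  move=> x ltx; apply/eqP/negPn; rewrite -memD; apply/negP => xD.
  by move: ltx; rewrite ltnNge leq_bigmax_seq.
have mD : m \in symdiff u v by rewrite memD mv (negPf mu).
have nD : symdiff u v != [::] by case: (symdiff u v) mD.
split=> //; suff -> : \max_(x <- symdiff u v) x = m by [].
apply/eqP; rewrite eqn_leq leq_bigmax_seq // andbT.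
apply/bigmax_leqP_seq => x; rewrite memD => xD _; rewrite leqNgt.
by apply: contra xD => /mE->.
Qed.

Lemma squashed_lt_irr : irreflexive squashed_lt.
Proof.
by move=> u; apply/negP => /squashed_ltP[m [mu]]; rewrite mu.
Qed.

(** Adjoining the same new maximum to two sets does not change their symmetric difference; between
    the two blocks the new maximum itself decides. *)
Lemma pairwise_squashed e d : pairwise (relpre rev squashed_lt) (squashed e d).
Proof.
have cons_lt e' d' : pairwise (relpre rev squashed_lt) (squashed e' d') ->
    pairwise (relpre rev squashed_lt) (map (cons (e' + d'.+1)) (squashed e' d')).
  rewrite pairwise_map; apply: (sub_in_pairwise _ (allss _)) => u v uE vE.
  move=> /squashed_ltP[m [mv mu mE]]; apply/squashed_ltP; exists m.
  have mt : m < e' + d'.+1 by rewrite addnS (ltn_squashed vE) // -mem_rev.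
  rewrite !mem_rev !inE in mv mu *; split.
  - by rewrite mv orbT.
  - by rewrite negb_or mu andbT; apply/eqP; lia.
  - by move=> x /mE; rewrite !mem_rev !inE => ->.
elim: e d => [|e IHe]; elim=> [|d IHd] //.
  by rewrite squashed0S; apply: (cons_lt 0).
rewrite squashedSS pairwise_cat IHe cons_lt // ?andbT.
apply/allrelP => u w uE /mapP[v vE ->]; apply/squashed_ltP.
have notin x : e.+1 + d.+1 <= x -> x \notin u.
  by move=> le; apply/negP => /(ltn_squashed uE); lia.
exists (e.+1 + d.+1); rewrite !mem_rev mem_head notin //; split=> // x ltx.
rewrite !mem_rev inE (negPf (notin _ (ltnW ltx))) gtn_eqF //=.
by apply/esym/negP => /(ltn_squashed vE); lia.
Qed.

Lemma filter_downset (T : eqType) (R : rel T) (F s : seq T) :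
  pairwise R s -> (forall x y, x \in s -> y \in F -> R x y -> x \in F) ->
  filter (mem F) s = take (count (mem F) s) s.
Proof.
elim: s => //= x s IHs /andP[/allP Rx ps] down.
have {}IHs : filter (mem F) s = take (count (mem F) s) s.
  by apply: IHs => // y z ys; apply: down; rewrite inE ys orbT.
have [xF|xF] := boolP (x \in F); first by rewrite /= IHs.
have c0 : count (mem F) s = 0.
  apply/eqP; rewrite -leqn0 leqNgt -has_count; apply/hasPn => y ys.
  by apply: contra xF => yF; apply: down (Rx y ys); rewrite ?mem_head.
by rewrite c0 take0 IHs c0 take0.
Qed.

Lemma mem_rev_squashed e d u : in_binom d u -> \max_(x <- u) x <= e ->
  rev u \in squashed e d.
Proof.
move=> /and3P[/eqP su ou pu] /bigmax_leqP_seq lu.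
rewrite mem_squashed size_rev su eqxx all_rev pu andbT /=.
rewrite (path_sortedE (rev_trans ltn_trans)) rev_sorted ou andbT all_rev.
apply/allP => x xu /=; have := lu x xu isT; lia.
Qed.

Lemma in_binom_rev e d r : r \in squashed e d -> in_binom d (rev r).
Proof.
rewrite mem_squashed (path_sortedE (rev_trans ltn_trans)).
move=> /and3P[sr /andP[_ or] pr].
by rewrite /in_binom size_rev sr all_rev rev_sorted or pr.
Qed.

Lemma compressed_prefix d F : uniq F -> all (in_binom d) F -> compressed d F ->
  exists e, size F <= size (squashed e d) /\ map rev F =i take (size F) (squashed e d).
Proof.
(* With [e] the largest element that occurs, all members of [F] are subsets of {1, ..., e + d}. *)
move=> uF bF cF; pose e := \max_(u <- F) \max_(x <- u) x; exists e.
have FE : {subset map rev F <= squashed e d}.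
  move=> _ /mapP[u uinF ->]; apply: mem_rev_squashed; first exact: (allP bF).
  exact: leq_bigmax_seq.
have urF : uniq (map rev F) by rewrite map_inj_uniq //; apply: (can_inj revK).
have uE : uniq (squashed e d).
  apply: pairwise_uniq (pairwise_squashed e d) => u; exact: squashed_lt_irr.
have fE : filter (mem (map rev F)) (squashed e d) =i map rev F.
  by move=> r; rewrite mem_filter /=; apply: andb_idr; apply: FE.
have sF : count (mem (map rev F)) (squashed e d) = size F.
  rewrite -size_filter -(size_map rev F); apply: perm_size.
  by apply: uniq_perm; rewrite ?filter_uniq.
split; first by rewrite -sF count_size.
move=> r; rewrite -fE (filter_downset (pairwise_squashed e d)) ?sF //.
move=> x y xE /mapP[u uinF ->] /=; rewrite revK => ltxu.
apply/mapP; exists (rev x); last by rewrite revK.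
by apply: cF ltxu => //; apply: in_binom_rev xE.
Qed.

(** * The maps in Inc_1 as threshold shifts *)

Lemma Inc1_cases pi j : Inc1 pi -> 0 < j -> pi j = j \/ pi j = j.+1.
Proof.
move=> incpi; elim: j => // j IHj _.
have := incpi j.+1 isT; case: j IHj => [|j] IHj; first by lia.
have := IHj isT; have := incpi j.+1 isT; lia.
Qed.

(** A map that moves [j] to [j.+1] must also move [j.+1], since it is strictly increasing; so the
    fixed points are closed downwards. *)
Lemma Inc1_fix pi j t : Inc1 pi -> 0 < j -> j <= t -> pi t = t -> pi j = j.
Proof.
move=> incpi j0 /subnKC <-; elim: (t - j) => [|k IHk]; first by rewrite addn0.
rewrite addnS => pit; apply: IHk.
have : 0 < j + k by lia.
move=> jk0; have := incpi _ jk0; have := Inc1_cases incpi jk0; lia.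
Qed.

Lemma shifts_Inc1 pi r : Inc1 pi -> sorted gtn r -> all (leq 1) r ->
  map pi r \in shifts r.
Proof.
move=> incpi; elim: r => // t v IHv /= pv /andP[t0 v0].
have pv' := pv; rewrite (path_sortedE (rev_trans ltn_trans)) in pv'.
case/andP: pv' => vt sv.
have [pit|pit] := Inc1_cases incpi t0; last first.
  by apply/shiftsP; right; exists (map pi v); rewrite ?pit ?IHv.
suff -> : map pi v = v by rewrite pit mem_head.
rewrite -[RHS]map_id; apply/eq_in_map => x xv.
by apply: Inc1_fix pit => //; [apply: (allP v0) | apply/ltnW/(allP vt)].
Qed.

Lemma Inc1_shifts r w : sorted gtn r -> w \in shifts r ->
  exists2 pi, Inc1 pi & w = map pi r.
Proof.
pose pi c j := j + (c <= j).
have incpi c : Inc1 (pi c) by move=> j j0; rewrite /pi; lia.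
move=> sr wr; suff [c ->] : exists c, w = map (pi c) r by exists (pi c).
elim: r w sr wr => [|t v IHv] w /=; first by rewrite inE => _ /eqP->; exists 0.
move=> pv; have := pv; rewrite (path_sortedE (rev_trans ltn_trans)) => /andP[vt sv].
move=> /shiftsP[->|[w' /(IHv _ sv)[c ->] ->]].
  exists t.+1; rewrite -[LHS]map_id; apply/eq_in_map => x.
  rewrite inE /pi => /predU1P[->|/(allP vt) /=]; lia.
(* The threshold of the tail may exceed [t]; lowering it to [t] makes [t] move and changes nothing
   on smaller elements. *)
exists (minn c t); rewrite /= /pi; congr (_ :: _); first by lia.
by apply/eq_in_map => x /(allP vt) /=; lia.
Qed.

Lemma has_card_IncImage d F : all (in_binom d) F ->
  has_card (IncImage F) (size (image_list (map rev F))).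
Proof.
move=> bF; exists (map rev (image_list (map rev F))).
split; first by rewrite map_inj_uniq ?undup_uniq //; apply: (can_inj revK).
  by rewrite size_map.
have sF u : u \in F -> sorted gtn (rev u) /\ all (leq 1) (rev u).
  by move=> /(allP bF) /and3P[_ ? ?]; rewrite rev_sorted all_rev.
move=> w; split=> [[u [pi [uF [incpi ->]]]]|/mapP[x /mem_image_list[r rF wr] ->]].
  apply/mapP; exists (rev (map pi u)); last by rewrite revK.
  apply/mem_image_list; exists (rev u); first exact: map_f.
  by have [? ?] := sF u uF; rewrite -map_rev; apply: shifts_Inc1.
case/mapP: rF => u uF rE; rewrite {}rE in wr.
have [su _] := sF u uF; have [pi incpi ->] := Inc1_shifts su wr.
by exists u, pi; rewrite map_rev revK.
Qed.

Theorem theorem1p4 (d : nat) (F : seq (seq nat)) :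
  0 < d -> uniq F -> all (in_binom d) F -> compressed d F ->
  forall F' : seq (seq nat),
    uniq F' -> all (in_binom d) F' -> size F' = size F ->
    exists n n', [/\ has_card (IncImage F) n, has_card (IncImage F') n' & n <= n'].
Proof.
move=> _ uF bF cF F' uF' bF' sF'.
exists (size (image_list (map rev F))), (size (image_list (map rev F'))).
split; [exact: has_card_IncImage bF | exact: has_card_IncImage bF' |].
have [e [leF FE]] := compressed_prefix uF bF cF.
(* The two bounds meet at n + h_d(n), with n the common size of the families. *)
apply: (@leq_trans (size F + psum (growth e d) (size F))).
  apply: leq_trans (size_image_list_take leF).
  apply: leq_image_list => w /mem_image_list[r rF wr].
  by apply/mem_image_list; exists r; rewrite // -FE.
rewrite -sF' -(size_map rev F'); apply: leq_size_image_list.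
- by rewrite map_inj_uniq //; apply: (can_inj revK).
- by apply/allP => _ /mapP[u /(allP bF')/and3P[su _ _] ->]; rewrite size_rev.
- by rewrite size_map sF' -size_squashed.
Qed.
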